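(* Let $p$ be a prime and let $K/F$ be a cyclic Galois extension of degree $p^n$, $n\ge 1$, with $\operatorname{char}F\neq p$ and with $F$ containing a primitive $p$th root of unity $\xi_p$. Let $\sigma$ be a generator of $\operatorname{Gal}(K/F)$ and let $A(K/F)=(K/F,\sigma,\xi_p)$. Then $$\operatorname{ind}A(K/F)\le p^{m(K/F)+1},$$ where for $m(K/F)=-\infty$ the right-hand side is interpreted as $1$.
   Context: Let $p$ be a prime and $K/F$ a cyclic Galois extension of degree $p^n$, $n\ge 1$, with $\operatorname{char}F\ne p$ and $F$ containing a primitive $p$th root of unity $\xi_p$. For $0\le i\le n$ let $K_i$ be the unique intermediate field $F\subseteq K_i\subseteq K$ with $[K_i:F]=p^i$. Define $$m(K/F)=\begin{cases}-\infty, & \xi_p\in N_{K/F}(K^\times),\\ \min\{s\in\{0,\dots,n\} : \xi_p\in N_{K/K_s}(K^\times)\}-1, & \xi_p\notin N_{K/F}(K^\times).\end{cases}$$ For a cyclic extension $L/E$ of degree $r>1$ with $\operatorname{Gal}(L/E)=\langle\tau\rangle$ and $b\in E^\times$, the cyclic algebra $(L/E,\tau,b)$ is the central simple $E$-algebra $\bigoplus_{0\le j<r}u^jL$ with $u^{-1}du=\tau(d)$ for all $d\in L$ and $u^r=b$. If $B$ is a central simple $E$-algebra with $B\simeq M_s(D)$, $D$ a division algebra, its Schur index is $\operatorname{ind}B=\sqrt{\dim_E D}$. *)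

(* Defs.v *)
From HB Require Import structures.
From mathcomp Require Import all_boot all_order all_fingroup all_algebra.
From mathcomp Require Import all_solvable all_field boolp classical_sets.

Set Implicit Arguments.
Unset Strict Implicit.
Unset Printing Implicit Defensive.

Import GRing.Theory.
Local Open Scope ring_scope.

(* [cyclic_algebra tau b] is (L/E, tau, b), where E is the fixed field of tau;
   when <[tau]> is the whole of Gal(L/F) we have E = F and #[tau] = [L : F].
   The function c stands for \sum_(j < #[tau]) u^j c_j; see [calgE] below. The
   parameter b only enters the multiplication. *)
Definition cyclic_algebra (F : fieldType) (L : splittingFieldType F)
    (tau : gal_of {:L}%AS) (b : F) : Type := {ffun 'I_#[tau]%g -> L}.

Section CyclicAlgebra.

Variables (F : fieldType) (L : splittingFieldType F).
Variables (tau : gal_of {:L}%AS) (b : F).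

Let r := #[tau]%g.

Local Notation cyclic_algebra := (cyclic_algebra tau b).

HB.instance Definition _ := Vector.copy cyclic_algebra {ffun 'I_r -> L}.

(* u^m d for an arbitrary exponent m, reduced by means of u^r = b. *)
Definition calg_mon (d : L) (m : nat) : cyclic_algebra :=
  [ffun k => if val k == (m %% r)%N then b ^+ (m %/ r) *: d else 0].

Definition calg_one : cyclic_algebra := calg_mon 1 0.

(* (u^i c)(u^j d) = u^(i+j) tau^j(c) d, because c u = u tau(c). *)
Definition calg_mul (x y : cyclic_algebra) : cyclic_algebra :=
  \sum_(i < r) \sum_(j < r) calg_mon ((tau ^+ j)%g (x i) * y j) (i + j).

Let r_gt0 : (0 < r)%N. Proof. exact: order_gt0. Qed.

Let galD (i j : nat) (d : L) :
  (tau ^+ (i + j))%g d = (tau ^+ j)%g ((tau ^+ i)%g d).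
Proof. by rewrite expgD galM ?memvf. Qed.

Let gal_modr (m : nat) (d : L) : (tau ^+ (m %% r))%g d = (tau ^+ m)%g d.
Proof. by rewrite expg_mod_order. Qed.

Lemma calg_mon0 m : calg_mon 0 m = 0.
Proof. by apply/ffunP => k; rewrite !ffunE scaler0 if_same. Qed.

Lemma calg_monD m : {morph calg_mon^~ m : c d / c + d}.
Proof.
by move=> c d; apply/ffunP => k; rewrite !ffunE scalerDr; case: ifP; rewrite ?addr0.
Qed.

Lemma calg_monZ m a d : calg_mon (a *: d) m = a *: calg_mon d m.
Proof.
apply/ffunP => k; rewrite !ffunE; case: ifP; rewrite ?scaler0 //.
by rewrite !scalerA mulrC.
Qed.

Lemma calg_mon_sum m (I : Type) (s : seq I) (P : pred I) (G : I -> L) :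
  calg_mon (\sum_(i <- s | P i) G i) m = \sum_(i <- s | P i) calg_mon (G i) m.
Proof. exact: (big_morph _ (calg_monD m) (calg_mon0 m)). Qed.

Lemma calg_monDr d q m : calg_mon d (q * r + m) = calg_mon (b ^+ q *: d) m.
Proof.
apply/ffunP => k; rewrite !ffunE modnMDl divnMDl //; case: ifP => // _.
by rewrite scalerA exprD mulrC.
Qed.

Lemma calg_mon_ord d (i k : 'I_r) : calg_mon d i k = if k == i then d else 0.
Proof. by rewrite ffunE modn_small // divn_small // expr0 scale1r. Qed.

Lemma calg_sum_mon (x : cyclic_algebra) : x = \sum_i calg_mon (x i) i.
Proof.
apply/ffunP => k; rewrite sum_ffunE (bigD1 k) //= big1 => [|i neq_ik].
  by rewrite calg_mon_ord eqxx addr0.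
by rewrite calg_mon_ord eq_sym (negPf neq_ik).
Qed.

Lemma calg_mulDl : left_distributive calg_mul +%R.
Proof.
move=> x y z; rewrite /calg_mul -big_split; apply: eq_bigr => i _ /=.
rewrite -big_split; apply: eq_bigr => j _ /=.
by rewrite ffunE rmorphD /= mulrDl calg_monD.
Qed.

Lemma calg_mulDr : right_distributive calg_mul +%R.
Proof.
move=> x y z; rewrite /calg_mul -big_split; apply: eq_bigr => i _ /=.
rewrite -big_split; apply: eq_bigr => j _ /=.
by rewrite ffunE mulrDr calg_monD.
Qed.

Lemma calg_scaleAl a x y : a *: calg_mul x y = calg_mul (a *: x) y.
Proof.
rewrite /calg_mul scaler_sumr; apply: eq_bigr => i _ /=.
rewrite scaler_sumr; apply: eq_bigr => j _ /=.
by rewrite ffunE linearZ /= -scalerAl calg_monZ.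
Qed.

Lemma calg_scaleAr a x y : a *: calg_mul x y = calg_mul x (a *: y).
Proof.
rewrite /calg_mul scaler_sumr; apply: eq_bigr => i _ /=.
rewrite scaler_sumr; apply: eq_bigr => j _ /=.
by rewrite ffunE -scalerAr calg_monZ.
Qed.

Lemma calg_mul0l x : calg_mul 0 x = 0.
Proof. by apply: (@addrI _ (calg_mul 0 x)); rewrite -calg_mulDl !addr0. Qed.

Lemma calg_mul0r x : calg_mul x 0 = 0.
Proof. by apply: (@addrI _ (calg_mul x 0)); rewrite -calg_mulDr !addr0. Qed.

Lemma calg_mul_suml (I : Type) (s : seq I) (P : pred I)
    (G : I -> cyclic_algebra) y :
  calg_mul (\sum_(i <- s | P i) G i) y = \sum_(i <- s | P i) calg_mul (G i) y.
Proof.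
exact: (big_morph (calg_mul^~ y) (fun u v => calg_mulDl u v y) (calg_mul0l y)).
Qed.

Lemma calg_mul_sumr (I : Type) (s : seq I) (P : pred I)
    (G : I -> cyclic_algebra) x :
  calg_mul x (\sum_(i <- s | P i) G i) = \sum_(i <- s | P i) calg_mul x (G i).
Proof. exact: (big_morph (calg_mul x) (calg_mulDr x) (calg_mul0r x)). Qed.

Let calg_mul_mon_ord c d (i j : 'I_r) :
  calg_mul (calg_mon c i) (calg_mon d j) =
  calg_mon ((tau ^+ j)%g c * d) (i + j).
Proof.
rewrite /calg_mul (bigD1 i) //= [X in _ + X]big1 => [|k neq_ki].
  rewrite addr0 (bigD1 j) //= [X in _ + X]big1 => [|k neq_kj].
    by rewrite addr0 !calg_mon_ord !eqxx.
  by rewrite [calg_mon d j k]calg_mon_ord (negPf neq_kj) mulr0 calg_mon0.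
apply: big1 => j0 _; rewrite calg_mon_ord (negPf neq_ki).
by rewrite rmorph0 mul0r calg_mon0.
Qed.

Let calg_mon_mod d m :
  calg_mon d m = calg_mon (b ^+ (m %/ r) *: d) (Ordinal (ltn_pmod m r_gt0)).
Proof. by rewrite {1}(divn_eq m r) calg_monDr. Qed.

Lemma calg_mul_mon c d m l :
  calg_mul (calg_mon c m) (calg_mon d l) =
  calg_mon ((tau ^+ l)%g c * d) (m + l).
Proof.
rewrite (calg_mon_mod c m) (calg_mon_mod d l) calg_mul_mon_ord /= gal_modr.
have -> : (m + l = (m %/ r + l %/ r) * r + (m %% r + l %% r))%N.
  by rewrite mulnDl addnACA -!divn_eq.
by rewrite calg_monDr linearZ /= -scalerAl -scalerAr scalerA exprD.
Qed.

Lemma calg_mulA : associative calg_mul.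
Proof.
move=> x y z; rewrite (calg_sum_mon x) (calg_sum_mon y) (calg_sum_mon z).
rewrite !calg_mul_suml; apply: eq_bigr => i _.
rewrite calg_mul_sumr [X in _ = calg_mul X _]calg_mul_sumr calg_mul_suml.
apply: eq_bigr => j _; rewrite !calg_mul_sumr; apply: eq_bigr => k _.
by rewrite !calg_mul_mon rmorphM /= galD mulrA addnA.
Qed.

Lemma calg_mul1l : left_id calg_one calg_mul.
Proof.
move=> x; rewrite {1}(calg_sum_mon x) calg_mul_sumr [RHS]calg_sum_mon.
by apply: eq_bigr => i _; rewrite calg_mul_mon rmorph1 mul1r add0n.
Qed.

Lemma calg_mul1r : right_id calg_one calg_mul.
Proof.
move=> x; rewrite {1}(calg_sum_mon x) calg_mul_suml [RHS]calg_sum_mon.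
by apply: eq_bigr => i _; rewrite calg_mul_mon expg0 gal_id mulr1 addn0.
Qed.

Lemma calg_one_neq0 : calg_one != 0.
Proof.
apply/eqP => /ffunP/(_ (Ordinal r_gt0)).
rewrite !ffunE mod0n div0n eqxx expr0 scale1r; exact/eqP/oner_neq0.
Qed.

HB.instance Definition _ := GRing.Zmodule_isNzRing.Build cyclic_algebra
  calg_mulA calg_mul1l calg_mul1r calg_mulDl calg_mulDr calg_one_neq0.

HB.instance Definition _ :=
  GRing.Lmodule_isLalgebra.Build F cyclic_algebra calg_scaleAl.

HB.instance Definition _ :=
  GRing.Lalgebra_isAlgebra.Build F cyclic_algebra calg_scaleAr.

HB.instance Definition _ := Algebra_isFalgebra.Build F cyclic_algebra.

Definition calg_u : cyclic_algebra := calg_mon 1 1.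

Definition calg_in (d : L) : cyclic_algebra := calg_mon d 0.

Lemma calg_in_is_zmod_morphism : zmod_morphism calg_in.
Proof.
by move=> c d; rewrite /calg_in calg_monD -scaleN1r calg_monZ scaleN1r.
Qed.

Lemma calg_in_is_monoid_morphism : monoid_morphism calg_in.
Proof.
by split=> // c d; rewrite [RHS]calg_mul_mon expg0 gal_id.
Qed.

Lemma calg_in_is_scalable : scalable calg_in.
Proof. by move=> a d; rewrite /calg_in calg_monZ. Qed.

HB.instance Definition _ :=
  GRing.isZmodMorphism.Build L cyclic_algebra calg_in calg_in_is_zmod_morphism.
HB.instance Definition _ :=
  GRing.isMonoidMorphism.Build L cyclic_algebra calg_in
    calg_in_is_monoid_morphism.
HB.instance Definition _ :=
  GRing.isScalable.Build F L cyclic_algebra *:%R calg_in calg_in_is_scalable.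

Lemma calg_uX m : calg_u ^+ m = calg_mon 1 m.
Proof.
elim: m => [|m IHm]; first by rewrite expr0.
by rewrite exprSr IHm [LHS]calg_mul_mon rmorph1 mul1r addn1.
Qed.

Lemma calg_commE d : calg_in d * calg_u = calg_u * calg_in (tau d).
Proof.
rewrite [LHS]calg_mul_mon [RHS]calg_mul_mon expg1 expg0 gal_id.
by rewrite mul1r mulr1.
Qed.

Lemma calg_u_order : calg_u ^+ #[tau]%g = b%:A.
Proof.
rewrite calg_uX -/r -[X in calg_mon _ X]addn0 -[X in (X + _)%N]mul1n.
by rewrite calg_monDr expr1 calg_monZ.
Qed.

Lemma calgE (x : cyclic_algebra) : x = \sum_(j < #[tau]%g) calg_u ^+ j * calg_in (x j).
Proof.
rewrite {1}(calg_sum_mon x); apply: eq_bigr => j _.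
by rewrite calg_uX [RHS]calg_mul_mon expg0 gal_id mul1r addn0.
Qed.

End CyclicAlgebra.

Section IntermediateFields.

Variables (F : fieldType) (L : splittingFieldType F).

(* The intermediate field of degree d over F, when there is exactly one. *)
Definition field_of_degree (d : nat) : {subfield L} :=
  xget 1%AS (fun E : {subfield L} => \dim E = d).

(* a lies in N_(L/E)(L^x) *)
Definition is_norm_from (E : {subfield L}) (a : L) : Prop :=
  exists2 x : L, x != 0 & galNorm E {:L} x = a.

(* m(L/F) for [L : F] = p ^ n; [None] stands for -oo. In the second case the
   minimum is positive, so the predecessor on nat is the subtraction of 1. *)
Definition mKF (p n : nat) (xi : F) : option nat :=
  let normed (s : 'I_n.+1) :=
    `[< is_norm_from (field_of_degree (p ^ s)) xi%:A >] in
  if `[< is_norm_from 1%AS xi%:A >] then None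
  else Some (\val [arg min_(s < ord_max | normed s) s]).-1.

Lemma field_of_degree_unique (E : {subfield L}) :
  galois 1%AS {:L}%AS -> cyclic 'Gal({:L} / 1)%g ->
  field_of_degree (\dim E) = E.
Proof.
move=> galL cycL.
have galE (M : {subfield L}) : galois M {:L}%AS.
  by apply: galoisS galL; rewrite sub1v subvf.
have cardE (M : {subfield L}) : (#|'Gal({:L} / M)%g| = \dim {:L} %/ \dim M)%N.
  by rewrite -(galois_dim (galE M)).
apply: xget_unique => // M eq_dim; apply: val_inj => /=.
rewrite -(galois_fixedField (galE M)) -(galois_fixedField (galE E)).
congr (fixedField _); apply/eqP.
by rewrite (eq_subG_cyclic cycL) ?galS ?sub1v //= !cardE eq_dim.
Qed.

Lemma dim_field_of_degree (d : nat) :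
  galois 1%AS {:L}%AS -> cyclic 'Gal({:L} / 1)%g -> (d %| \dim {:L})%N ->
  \dim (field_of_degree d) = d.
Proof.
move=> galL cycL d_dvd.
have card_gal : #|'Gal({:L} / 1)%g| = \dim {:L}.
  by rewrite -(galois_dim galL) dimv1 divn1.
have [s def_gal] := cyclicP cycL; have ord_s : #[s]%g = \dim {:L}.
  by rewrite -card_gal def_gal.
have d_gt0 : (0 < d)%N by apply: dvdn_gt0 d_dvd; rewrite adim_gt0.
pose H := <[(s ^+ d)%g]>%G; pose E := [aspace of fixedField H].
suffices dimE : \dim E = d.
  by apply: (@xgetPex _ 1%AS (fun E : {subfield L} => \dim E = d)); exists E.
have cardH : (#|H| = \dim {:L} %/ d)%N by rewrite -ord_s -orderXdiv ?ord_s.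
have dimHE : (#|H| * \dim E)%N = \dim {:L}.
  by rewrite (dim_fixedField H) -dim_sup_field ?subvf.
apply/eqP; rewrite -(@eqn_pmul2l #|H|) ?cardG_gt0 // dimHE cardH.
by rewrite divnK.
Qed.

End IntermediateFields.

(* p^(m+1), read as 1 when m = -oo *)
Definition expp_succ (p : nat) (m : option nat) : nat :=
  if m is Some k then (p ^ k.+1)%N else 1%N.

Section SchurIndex.

Variable F : fieldType.

Definition is_division_algebra (D : falgType F) : Prop :=
  forall x : D, x != 0 -> x \is a GRing.unit.

(* d is the Schur index of the central simple algebra B; such a d exists and is
   unique by Wedderburn's theorem.
   The library views 'M[D]_n as a left D-module only, so the F-linearity of the
   ring isomorphism f is expressed by its values on the scalars. *)
Definition is_schur_index (B : falgType F) (d : nat) : Prop :=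
  exists (D : falgType F) (s : nat) (f : {rmorphism B -> 'M[D]_s.+1}),
    [/\ is_division_algebra D, bijective f,
        forall a : F, f a%:A = (a%:A)%:M & (d ^ 2)%N = \dim {:D}].

End SchurIndex.

(* Main.v *)
From HB Require Import structures.
Require Import Defs.
From mathcomp Require Import all_boot all_order all_fingroup all_algebra.
From mathcomp Require Import all_solvable all_field.
From mathcomp Require boolp.

(* Let [E] be an intermediate field with [[E : F] = e], let [A = (K/F, sigma, b)]
   and suppose [b = N_(K/E)(x)]. Put [w = u^e x^-1] and [q = [K : E]]. Then
   [w^q = b N_(K/E)(x)^-1 = 1], so [T = 1 + w + ... + w^(q-1)] is a nonzero element
   with [w T = T]. Hence [A T = \sum_(i < e) u^i K T] has dimension at most
   [e [K : F]]. If [A = M_s(D)] with [dim D = d^2], a nonzero left ideal has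
   dimension at least [s d^2 = d [K : F]], so [d <= e]. *)

Set Implicit Arguments.
Unset Strict Implicit.
Unset Printing Implicit Defensive.

Import GRing.Theory.
Local Open Scope ring_scope.

Section CyclicAlgebraLeftIdeal.

Variables (F : fieldType) (K : splittingFieldType F).
Variables (sigma : gal_of {:K}%AS) (b : F).

Local Notation A := (cyclic_algebra sigma b).
Local Notation mon := (@calg_mon F K sigma b).
Local Notation r := #[sigma]%g.

Lemma mulr_calg_mon c d m l :
  mon c m * mon d l = mon ((sigma ^+ l)%g c * d) (m + l).
Proof. exact: calg_mul_mon. Qed.

(** Moving [z] past [u^e] applies [sigma ^+ e], so the powers collect a partial norm of [z]. *)
Lemma calg_mon_exp e z k :
  mon z e ^+ k = mon (\prod_(j < k) (sigma ^+ (e * j))%g z) (e * k).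
Proof.
elim: k => [|k IHk]; first by rewrite big_ord0 muln0.
by rewrite exprS IHk mulr_calg_mon big_ord_recr /= mulrC -mulnS.
Qed.

Variables (e q : nat) (x : K).
Hypothesis order_sigma : r = (e * q)%N.
Hypothesis x_neq0 : x != 0.
Hypothesis norm_x : \prod_(j < q) (sigma ^+ (e * j))%g x = b%:A.

Let w : A := mon x^-1 e.
Let t : A := \sum_(k < q) w ^+ k.

Let e_gt0 : (0 < e)%N.
Proof. by have := order_gt0 sigma; rewrite order_sigma muln_gt0 => /andP[]. Qed.

Let q_gt0 : (0 < q)%N.
Proof. by have := order_gt0 sigma; rewrite order_sigma muln_gt0 => /andP[]. Qed.

Let w_exp_q : w ^+ q = 1.
Proof.
(* The exponent [e * q = r] is written [1 * r + 0] so that [calg_monDr] turns [u^r] into [b], which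
   cancels the inverse norm. *)
have -> : w ^+ q = mon (\prod_(j < q) (sigma ^+ (e * j))%g x)^-1 (1 * r + 0).
  rewrite calg_mon_exp mul1n addn0 order_sigma -prodfV; congr (mon _ _).
  by apply: eq_bigr => j _; rewrite fmorphV.
rewrite calg_monDr expr1 norm_x -(mulr_algl b _^-1) divff //.
by rewrite -norm_x; apply/prodf_neq0 => j _; rewrite fmorph_eq0.
Qed.

Let w_fix : w * t = t.
Proof.
rewrite /t; case: q q_gt0 w_exp_q => // q' _ wq1.
rewrite mulr_sumr big_ord_recr big_ord_recl /= -exprS wq1 expr0 addrC.
by congr (_ + _); apply: eq_bigr => k _; rewrite -exprS.
Qed.

(** The coefficient at [u^0] is 1: for [0 < k < q], [w ^+ k] lies in [u^(e * k) K] with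
    [0 < e * k < r]. *)
Let t_neq0 : t != 0.
Proof.
apply/eqP => /ffunP/(_ (Ordinal (order_gt0 sigma))).
rewrite sum_ffunE (bigD1 (Ordinal q_gt0)) //= big1 => [|k k_neq0].
  rewrite expr0 !ffunE mod0n div0n eqxx expr0 scale1r addr0.
  exact/eqP/oner_neq0.
rewrite calg_mon_exp !ffunE /= modn_small ?order_sigma ?ltn_pmul2l //.
by rewrite eq_sym muln_eq0 (gtn_eqF e_gt0) (negPf (k_neq0 : val k != 0%N)).
Qed.

(* [u^e] maps [K t] to itself, since [t] is fixed by [w = u^e x^-1]. *)
Let calg_mon_mul_t j c : exists i : 'I_e, exists c', mon c j * t = mon c' i * t.
Proof.
have [m] := ubnP j; elim: m j c => // m IHm j c /ltnSE le_jm.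
have [lt_je | le_ej] := ltnP j e; first by exists (Ordinal lt_je), c.
(* Insert [t = w * t] on the right; the new coefficient [c'] solves [(sigma ^+ e)(c') / x = c]. *)
have -> : mon c j * t = mon ((sigma ^+ e)^-1%g (c * x)) (j - e) * t.
  rewrite -{2}w_fix mulrA mulr_calg_mon subnK //.
  by rewrite -galM ?memvf // mulVg gal_id mulfK.
apply: IHm; rewrite (leq_trans _ le_jm) // ltn_subrL e_gt0.
exact: leq_trans le_ej.
Qed.

(** Placing the left ideal inside the image of a linear map from [K^e] encodes the bound [e [K : F]]
    on its dimension. *)
Lemma small_left_ideal : exists (T : A) (h : 'Hom({ffun 'I_e -> K}, A)),
  T != 0 /\ forall a, a * T \in limg h.
Proof.
pose g (c : {ffun 'I_e -> K}) : A := \sum_(i < e) mon (c i) i * t.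
have g_linear : linear g.
  move=> a c d; rewrite /g scaler_sumr -big_split; apply: eq_bigr => i _ /=.
  by rewrite !ffunE calg_monD calg_monZ mulrDl scalerAl.
pose gL := GRing.isLinear.Build _ _ _ _ g g_linear.
pose G : {linear {ffun 'I_e -> K} -> A} := HB.pack g gL.
exists t, (linfun G); split=> // a.
rewrite [a]calg_sum_mon mulr_suml; apply: rpred_sum => j _.
have [i [c ->]] := calg_mon_mul_t j (a j).
apply/memv_imgP; exists [ffun k => if k == i then c else 0]; rewrite ?memvf //.
rewrite lfunE /= /g (bigD1 i) //= big1 => [|k /negPf neq_ki].
  by rewrite ffunE eqxx addr0.
by rewrite ffunE neq_ki calg_mon0 mul0r.
Qed.

End CyclicAlgebraLeftIdeal.

Section MatrixAlgebra.

Variables (F : fieldType) (B D : falgType F) (s : nat).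
Variable f : {rmorphism B -> 'M[D]_s.+1}.
Hypothesis f_alg : forall a : F, f a%:A = (a%:A)%:M.

Lemma matrix_morphZ a x i j : f (a *: x) i j = a *: f x i j.
Proof. by rewrite -mulr_algl rmorphM f_alg -mulmxE mul_scalar_mx mxE mulr_algl. Qed.

Lemma dim_matrix_algebra_le :
  injective f -> (\dim {:B} <= s.+1 ^ 2 * \dim {:D})%N.
Proof.
move=> f_inj.
pose g (x : B) : {ffun 'I_s.+1 * 'I_s.+1 -> D} := [ffun ij => f x ij.1 ij.2].
have g_linear : linear g.
  move=> a x y; apply/ffunP => ij; rewrite !ffunE.
  by rewrite rmorphD mxE matrix_morphZ.
pose gL := GRing.isLinear.Build _ _ _ _ g g_linear.
pose G : {linear B -> {ffun 'I_s.+1 * 'I_s.+1 -> D}} := HB.pack g gL.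
have kerG : lker (linfun G) == 0%VS.
  apply/lker0P => x y; rewrite !lfunE /= => /ffunP eq_g.
  by apply/f_inj/matrixP => i j; have := eq_g (i, j); rewrite !ffunE.
have := dimvS (subvf (limg (linfun G))).
rewrite limg_dim_eq; last by rewrite (eqP kerG) capv0.
by rewrite !dimvf /dim /= card_prod card_ord.
Qed.

(** If entry [(k, l)] of [f T] is nonzero, left multiples of [T] realise every vector of [D^(s+1)]
    as their column [l], so [V] maps onto [D^(s+1)]. *)
Lemma dim_left_ideal_ge (V : vectType F) (h : 'Hom(V, B)) (T : B) :
    is_division_algebra D -> bijective f -> T != 0 ->
    (forall a, a * T \in limg h) ->
  (s.+1 * \dim {:D} <= \dim {:V})%N.
Proof.
move=> divD bij_f T_neq0 T_ideal; have [f' fK f'K] := bij_f.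
have /existsP[[k l] /= M_neq0] : [exists kl, f T kl.1 kl.2 != 0].
  apply: contraNT T_neq0 => /existsPn f0.
  rewrite -(inj_eq (can_inj fK)) rmorph0; apply/eqP/matrixP => k l.
  by rewrite [RHS]mxE; apply/eqP/negPn; apply: (f0 (k, l)).
pose g (v : V) : {ffun 'I_s.+1 -> D} := [ffun i => f (h v) i l].
have g_linear : linear g.
  move=> a x y; apply/ffunP => i; rewrite !ffunE.
  by rewrite linearP rmorphD mxE matrix_morphZ.
pose gL := GRing.isLinear.Build _ _ _ _ g g_linear.
pose G : {linear V -> {ffun 'I_s.+1 -> D}} := HB.pack g gL.
have imG : limg (linfun G) = fullv.
  apply/eqP; rewrite eqEsubv subvf /=; apply/subvP => y _.
  (* Only column [k] is nonzero, so column [l] of [f (a * T)] is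
     [(y i / f T k l) * f T k l = y i]. *)
  pose a := f' (\matrix_(i, j) if j == k then y i / f T k l else 0).
  have /memv_imgP[v _ aT] := T_ideal a.
  apply/memv_imgP; exists v; first exact: memvf.
  rewrite (lfunE G); apply/ffunP => i.
  rewrite ffunE -aT rmorphM f'K mxE (bigD1 k) //= big1 => [|j /negPf neq_jk].
    by rewrite !mxE eqxx addr0 divrK // divD.
  by rewrite !mxE neq_jk mul0r.
have := limg_ker_dim (linfun G) fullv; rewrite imG => <-.
by apply: leq_trans (leq_addl _ _); rewrite !dimvf /dim /= card_ord.
Qed.

End MatrixAlgebra.

(** This turns [galNorm], a product over a cyclic Galois group, into a product over the powers of
    its generator. *)
Lemma big_cycle (gT : finGroupType) (R : Type) (idx : R)
    (op : Monoid.com_law idx) (a : gT) (G : gT -> R) :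
  \big[op/idx]_(y in <[a]>%g) G y = \big[op/idx]_(j < #[a]%g) G (a ^+ j)%g.
Proof.
have cycle_imset : <[a]>%g = [set (a ^+ nat_of_ord j)%g | j : 'I_(#[a]%g)].
  apply/setP => y; apply/idP/imsetP => [/cyclePmin[j lt_ja ->] | [j _ ->]].
    by exists (Ordinal lt_ja).
  exact: mem_cycle.
rewrite {1}cycle_imset big_imset //= => i j _ _ /eqP.
by rewrite eq_expg_mod_order !modn_small // => /eqP/val_inj.
Qed.

Lemma schur_index_le_dim_norm (F : fieldType) (K : splittingFieldType F)
    (E : {subfield K}) (b : F) (sigma : gal_of {:K}%AS) (d : nat) :
    galois 1%AS {:K}%AS -> generator 'Gal({:K} / 1)%g sigma ->
    is_norm_from E b%:A -> is_schur_index (cyclic_algebra sigma b) d ->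
  (d <= \dim E)%N.
Proof.
move=> galK /eqP sigma_gen [x x_neq0 norm_x] [D [s [f]]].
move=> [divD bij_f f_alg dimD].
have galEK : galois E {:K}%AS by apply: galoisS galK; rewrite sub1v subvf.
have order_sigma : #[sigma]%g = \dim {:K}.
  by rewrite /order -sigma_gen -(galois_dim galK) dimv1 divn1.
pose e := \dim E; pose q := (\dim {:K} %/ e)%N.
have e_gt0 : (0 < e)%N by exact: adim_gt0.
have dimK : \dim {:K} = (e * q)%N.
  by rewrite mulnC divnK // field_dimS ?subvf.
have order_tau : #[(sigma ^+ e)%g]%g = q.
  by rewrite orderXdiv order_sigma // dimK dvdn_mulr.
(* Both are subgroups of order [q] in a cyclic group, hence equal. *)
have gal_tau : 'Gal({:K} / E)%g = <[(sigma ^+ e)%g]>%g.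
  apply/eqP; have cycK : cyclic 'Gal({:K} / 1)%g.
    by apply/cyclicP; exists sigma.
  rewrite (eq_subG_cyclic cycK) ?galS ?sub1v //=.
    by rewrite -(galois_dim galEK) -/(order _) order_tau.
  by rewrite sigma_gen cycleX.
have norm_x_prod : \prod_(j < q) (sigma ^+ (e * j))%g x = b%:A.
  rewrite -norm_x /galNorm gal_tau big_cycle order_tau.
  by apply: eq_bigr => j _; rewrite expgM.
have [T [h [T_neq0 T_ideal]]] :=
  small_left_ideal (etrans order_sigma dimK) x_neq0 norm_x_prod.
have := dim_left_ideal_ge f_alg divD bij_f T_neq0 T_ideal.
have := dim_matrix_algebra_le f_alg (bij_inj bij_f).
have -> : \dim {:cyclic_algebra sigma b} = (\dim {:K} ^ 2)%N.
  by rewrite !dimvf /dim /= card_ord order_sigma dimvf.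
have -> : \dim {:{ffun 'I_e -> K}} = (e * \dim {:K})%N.
  by rewrite !dimvf /dim /= card_ord.
(* Square roots give [[K : F] <= (s+1) d]; then [d [K : F] <= (s+1) d^2 <= e [K : F]]. *)
rewrite -dimD -expnMn leq_exp2r // => le_dimK le_sd.
rewrite -(@leq_pmul2r (\dim {:K})) ?adim_gt0 //.
apply: leq_trans le_sd; rewrite expnS expn1 mulnCA.
by rewrite leq_mul2l le_dimK orbT.
Qed.

Theorem mainTheorem3 (p n : nat) (F : fieldType) (K : splittingFieldType F)
    (xi : F) (sigma : gal_of {:K}%AS) (d : nat)
    (p_prime : prime p) (n_ge1 : (1 <= n)%N)
    (galK : galois 1%AS {:K}%AS) (cycK : cyclic 'Gal({:K} / 1)%g)
    (dimK : \dim {:K} = (p ^ n)%N)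
    (charF : p \notin [pchar F]%R) (xiP : (p.-primitive_root xi)%R)
    (sigmaP : generator 'Gal({:K} / 1)%g sigma)
    (ind_d : is_schur_index (cyclic_algebra sigma xi) d) :
  (d <= expp_succ p (mKF K p n xi))%N.
Proof.
have le_dim (E : {subfield K}) : is_norm_from E xi%:A -> (d <= \dim E)%N.
  by move=> normE; exact: schur_index_le_dim_norm galK sigmaP normE ind_d.
rewrite /mKF; case: ifP => [/boolp.asboolP/le_dim | _]; first by rewrite dimv1.
case: arg_minnP => [|t /boolp.asboolP/le_dim + _].
  (* The minimum ranges over a nonempty set: at [s = n] the field is [K] itself, and the norm from
     [K] to [K] is the identity. *)
  apply/boolp.asboolP; rewrite /= -dimK (@field_of_degree_unique F K {:K}%AS) //.
  have xi_neq0 : xi != 0 by rewrite (prim_root_eq0 xiP) -lt0n prime_gt0.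
  exists xi%:A; first by rewrite scaler_eq0 (negPf xi_neq0) oner_eq0.
  have gal1 : 'Gal({:K} / {:K})%g = 1%g.
    apply/eqP; rewrite trivg_card1 -galois_dim ?divnn ?adim_gt0 //.
    by apply: galoisS galK; rewrite sub1v subvv.
  by rewrite /galNorm gal1 big_set1 gal_id.
have le_tn : (t <= n)%N by rewrite -ltnS.
rewrite dim_field_of_degree ?dimK ?dvdn_exp2l // => /leq_trans; apply.
(* [t <= t.-1.+1] holds also at [t = 0], where the predecessor is truncated. *)
by rewrite leq_exp2l ?prime_gt1 // leqSpred.
Qed.
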